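(* Let $\alpha,\beta\in(1,2)$, let $d,e$ be nonnegative functions on $\Omega=(x_L,x_R)\times(y_L,y_R)$, and let $\varphi$, $f$ be given functions on $\bar\Omega$ and $\bar\Omega\times[0,T]$. For any $Q\in\mathfrak{D}$, the finite difference scheme $$\frac1{\tau}\left(u^{n}-u^{n-1}\right)=\left(\frac{1}{2h_1^\alpha}D(I\otimes G_\alpha)+\frac{1}{2h_2^\beta}E(G_\beta\otimes I)\right)\left(u^{n-1}+u^{n}\right)+f^{n-\frac12},\qquad 1\le n\le N,$$ with $u^0=\varphi$ (the vector of grid values of $\varphi$), is unconditionally stable, and its solution satisfies $$\left\|u^{n}\right\|_{Q}^2\leq \exp(2T)\left\|\varphi\right\|_{Q}^2+[\exp(2T)-1]\max_{1\leq k\leq n}\left\|f^{k-\frac12}\right\|_{Q}^2,\qquad n=1,2,\ldots,N.$$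
   Context: Let $T>0$, $M_1,M_2,N$ positive integers, $\tau=T/N$, $h_1=\frac{x_R-x_L}{M_1+1}$, $h_2=\frac{y_R-y_L}{M_2+1}$, $x_i=x_L+ih_1$, $y_j=y_L+jh_2$, $t_n=n\tau$, $t_{n-\frac12}=(t_{n-1}+t_n)/2$. Vectors of grid values are ordered with the $x$-index running fastest: $u^n=(u^n_{1,1},\dots,u^n_{M_1,1},u^n_{1,2},\dots,u^n_{M_1,2},\dots,u^n_{M_1,M_2})^T$, and likewise $f^{n-\frac12}$ has entries $f(x_i,y_j,t_{n-\frac12})$ and $\varphi$ entries $\varphi(x_i,y_j)$, $1\le i\le M_1$, $1\le j\le M_2$. $D$ and $E$ are the diagonal matrices with diagonal entries $d(x_i,y_j)$ and $e(x_i,y_j)$ in the same order. For $\gamma\in(1,2)$ define $g_0^{(\gamma)}=1$, $g_k^{(\gamma)}=\left(1-\frac{\gamma+1}{k}\right)g_{k-1}^{(\gamma)}$ $(k\ge1)$, $w_0^{(\gamma)}=\frac{\gamma}{2}g_0^{(\gamma)}$, $w_k^{(\gamma)}=\frac{\gamma}{2}g_k^{(\gamma)}+\frac{2-\gamma}{2}g_{k-1}^{(\gamma)}$ $(k\ge1)$. $G_\gamma$ is the Toeplitz matrix with $(i,j)$ entry $w_{i-j+1}^{(\gamma)}$ if $i-j+1\ge0$ and $0$ otherwise; $G_\alpha$ has size $M_1\times M_1$ and $G_\beta$ has size $M_2\times M_2$. $\otimes$ is the Kronecker product and $I$ an identity matrix of the appropriate size ($M_2$ in $I\otimes G_\alpha$,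 $M_1$ in $G_\beta\otimes I$). Put $A=\frac{1}{2h_1^\alpha}D(I\otimes G_\alpha)+\frac{1}{2h_2^\beta}E(G_\beta\otimes I)$ and, for a square matrix $X$, let $\mathcal{H}(X)=(X+X^T)/2$ be its symmetric part. $\mathfrak{D}$ is the set of (real symmetric) matrices $X$, understood as depending on the discretization, such that $X$ is positive definite, $-\mathcal{H}(XA)$ is positive semidefinite, and $\mathrm{cond}(X)=\|X\|_2\|X^{-1}\|_2\le c$ for a constant $c$ independent of $\tau,h_1,h_2$. The norm is $\|v\|_Q^2:=h\,v^TQv$, where $h=h_1h_2$. ''Unconditionally stable'' means that the displayed estimate holds with no restriction relating $\tau$, $h_1$ and $h_2$. *)

(* Defs.v *)
From mathcomp Require Import all_boot all_order all_algebra.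
From mathcomp Require Import classical_sets reals sequences exp.
From mathcomp Require Import mxtens.

Set Implicit Arguments.
Unset Strict Implicit.
Unset Printing Implicit Defensive.

Import Order.TTheory GRing.Theory Num.Theory.

Local Open Scope classical_set_scope.
Local Open Scope ring_scope.

Fixpoint g_coef (R : realType) (gam : R) (k : nat) : R :=
  if k is k'.+1 then (1 - (gam + 1) / k%:R) * g_coef gam k' else 1.

Definition w_coef (R : realType) (gam : R) (k : nat) : R :=
  if k is k'.+1 then
    gam / 2 * g_coef gam k + (2 - gam) / 2 * g_coef gam k'
  else gam / 2 * g_coef gam 0%N.

Definition G_mx (R : realType) (gam : R) (n : nat) : 'M[R]_n :=
  \matrix_(i, j) (if (j <= i.+1)%N then w_coef gam (i.+1 - j)%N else 0).

(* M is the number of interior nodes of (a, b). *)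
Definition mesh (R : realType) (a b : R) (M : nat) : R := (b - a) / M.+1%:R.

(* Ordinals are 0-based, so i : 'I_M stands for the (i+1)-st interior node. *)
Definition node (R : realType) (a b : R) (M : nat) (i : 'I_M) : R :=
  a + i.+1%:R * mesh a b M.

(* For k : 'I_(M2 * M1), mxtens_unindex k = (k %/ M1, k %% M1) is the pair
   (y-index, x-index): the x-index runs fastest, consistently with tensmx. *)
Definition grid_vec (R : realType) (xL xR yL yR : R) (M1 M2 : nat)
    (v : R -> R -> R) : 'cV[R]_(M2 * M1) :=
  \col_k v (node xL xR (mxtens_unindex k).2) (node yL yR (mxtens_unindex k).1).

Definition grid_diag (R : realType) (xL xR yL yR : R) (M1 M2 : nat)
    (v : R -> R -> R) : 'M[R]_(M2 * M1) :=
  diag_mx (grid_vec xL xR yL yR M1 M2 v)^T.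

(* tensmx is the Kronecker product. *)
Definition A_mx (R : realType) (alpha beta xL xR yL yR : R)
    (d e : R -> R -> R) (M1 M2 : nat) : 'M[R]_(M2 * M1) :=
  (2 * mesh xL xR M1 `^ alpha)^-1 *:
    (grid_diag xL xR yL yR M1 M2 d *m tensmx 1%:M (G_mx alpha M1))
  + (2 * mesh yL yR M2 `^ beta)^-1 *:
    (grid_diag xL xR yL yR M1 M2 e *m tensmx (G_mx beta M2) 1%:M).

Definition qform (R : realType) (m : nat) (X : 'M[R]_m) (v : 'cV[R]_m) : R :=
  (v^T *m X *m v) 0 0.

Definition pos_def (R : realType) (m : nat) (X : 'M[R]_m) : Prop :=
  X^T = X /\ forall v : 'cV[R]_m, v != 0 -> 0 < qform X v.

Definition pos_semidef (R : realType) (m : nat) (X : 'M[R]_m) : Prop :=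
  X^T = X /\ forall v : 'cV[R]_m, 0 <= qform X v.

Definition sym_part (R : realType) (m : nat) (X : 'M[R]_m) : 'M[R]_m :=
  2^-1 *: (X + X^T).

Definition l2norm (R : realType) (m : nat) (v : 'cV[R]_m) : R :=
  Num.sqrt (\sum_i v i 0 ^+ 2).

(* The operator norm induced by l2norm; the norm that MathComp-Analysis puts
   on matrices is the entrywise maximum. *)
Definition spectral_norm (R : realType) (m : nat) (X : 'M[R]_m) : R :=
  sup [set l2norm (X *m v) | v in [set v : 'cV[R]_m | l2norm v <= 1]].

Definition cond2 (R : realType) (m : nat) (X : 'M[R]_m) : R :=
  spectral_norm X * spectral_norm (invmx X).

(* Membership in the class D is a property of a whole family of matrices,
   indexed by the discretization (M1, M2, N), because the bound c on the
   condition numbers is uniform. *)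
Definition class_D (R : realType) (A : forall M1 M2 : nat, 'M[R]_(M2 * M1))
    (X : forall M1 M2 N : nat, 'M[R]_(M2 * M1)) : Prop :=
  exists c : R, forall M1 M2 N : nat,
    (0 < M1)%N -> (0 < M2)%N -> (0 < N)%N ->
    [/\ pos_def (X M1 M2 N),
        pos_semidef (- sym_part (X M1 M2 N *m A M1 M2))
      & cond2 (X M1 M2 N) <= c].

Definition sqnorm (R : realType) (h : R) (m : nat) (Q : 'M[R]_m)
    (v : 'cV[R]_m) : R :=
  h * qform Q v.

Definition time_node (R : realType) (T : R) (N n : nat) : R :=
  n%:R * (T / N%:R).

Definition time_mid (R : realType) (T : R) (N n : nat) : R :=
  (time_node T N n.-1 + time_node T N n) / 2.

Definition f_mid (R : realType) (xL xR yL yR T : R) (f : R -> R -> R -> R)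
    (M1 M2 N n : nat) : 'cV[R]_(M2 * M1) :=
  grid_vec xL xR yL yR M1 M2 (fun x y => f x y (time_mid T N n)).

(* Only the values u 0, ..., u N are constrained. *)
Definition scheme_solution (R : realType) (alpha beta xL xR yL yR T : R)
    (d e phi : R -> R -> R) (f : R -> R -> R -> R) (M1 M2 N : nat)
    (u : nat -> 'cV[R]_(M2 * M1)) : Prop :=
  u 0%N = grid_vec xL xR yL yR M1 M2 phi /\
  forall n : nat, (1 <= n <= N)%N ->
    (T / N%:R)^-1 *: (u n - u n.-1) =
      A_mx alpha beta xL xR yL yR d e M1 M2 *m (u n.-1 + u n)
      + f_mid xL xR yL yR T f M1 M2 N n.

(* The maximum of F 1, ..., F n, for n >= 1. *)
Definition max_upto (R : realType) (F : nat -> R) (n : nat) : R :=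
  \big[Num.max/F 1%N]_(1 <= k < n.+1) F k.

(* Main.v *)
Require Import Defs.
From mathcomp Require Import all_boot all_order all_algebra.
From mathcomp Require Import classical_sets reals sequences exp.
From mathcomp Require Import ring lra.
Import Order.TTheory GRing.Theory Num.Theory.
Local Open Scope ring_scope.

(** Test the scheme against [u n.-1 + u n] in the inner product of a weight
    [X] (a positive multiple of [Q]).  Since [X] is symmetric, the difference
    quotient becomes [(|u n|^2 - |u n.-1|^2) / tau], and the term in [A] is
    nonpositive, because it is a value of the quadratic form of [X *m A], which
    only sees the symmetric part of that matrix.  Cauchy-Schwarz bounds the
    source term by [(|u n| + |u n.-1|) * |f|]; cancelling the common factor
    [|u n| + |u n.-1|] gives [|u n| <= |u n.-1| + tau * |f|]
    (lemma [energy_norm_step]).  Working with norms rather than with their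
    squares is what makes the estimate unconditional: no term in [|u n|^2] has
    to be absorbed on the left, so [tau] need not be small.

    Summing over the steps yields [|u n| <= |phi| + T * F], where [F] bounds
    the norms of the source terms.  The exponential only enters when this is
    squared: [2 * T * |phi| * F <= T * |phi|^2 + T * F^2], and
    [1 + T + T^2 <= expR (2 * T)] (lemma [sqrD_le_expR]). *)

Definition bform {R : realType} {m : nat} (X : 'M[R]_m) (v w : 'cV[R]_m) : R :=
  (v^T *m X *m w) 0 0.

Lemma bformDl (R : realType) (m : nat) (X : 'M[R]_m) (v w z : 'cV[R]_m) :
  bform X (v + w) z = bform X v z + bform X w z.
Proof. by rewrite /bform linearD /= !mulmxDl mxE. Qed.

Lemma bformDr (R : realType) (m : nat) (X : 'M[R]_m) (v w z : 'cV[R]_m) :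
  bform X v (w + z) = bform X v w + bform X v z.
Proof. by rewrite /bform mulmxDr mxE. Qed.

Lemma bformZl (R : realType) (m : nat) (X : 'M[R]_m) a (v w : 'cV[R]_m) :
  bform X (a *: v) w = a * bform X v w.
Proof. by rewrite /bform linearZ /= -!scalemxAl mxE. Qed.

Lemma bformZr (R : realType) (m : nat) (X : 'M[R]_m) a (v w : 'cV[R]_m) :
  bform X v (a *: w) = a * bform X v w.
Proof. by rewrite /bform -scalemxAr mxE. Qed.

Lemma bformNr (R : realType) (m : nat) (X : 'M[R]_m) (v w : 'cV[R]_m) :
  bform X v (- w) = - bform X v w.
Proof. by rewrite -scaleN1r bformZr mulN1r. Qed.

Lemma bform_tr (R : realType) (m : nat) (X : 'M[R]_m) (v w : 'cV[R]_m) :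
  bform X^T v w = bform X w v.
Proof.
rewrite /bform; have -> : v^T *m X^T *m w = (w^T *m X *m v)^T.
  by rewrite !trmx_mul trmxK mulmxA.
by rewrite mxE.
Qed.

Lemma qformE (R : realType) (m : nat) (X : 'M[R]_m) (v : 'cV[R]_m) :
  qform X v = bform X v v.
Proof. by []. Qed.

Lemma qformZ (R : realType) (m : nat) (X : 'M[R]_m) a (v : 'cV[R]_m) :
  qform (a *: X) v = a * qform X v.
Proof. by rewrite /qform -scalemxAr -scalemxAl mxE. Qed.

Lemma qform_sym_part (R : realType) (m : nat) (X : 'M[R]_m) (v : 'cV[R]_m) :
  qform (- sym_part X) v = - qform X v.
Proof.
have qformD (Y Z : 'M[R]_m) : qform (Y + Z) v = qform Y v + qform Z v.
  by rewrite /qform mulmxDr mulmxDl mxE.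
rewrite -scaleN1r qformZ qformZ qformD.
by rewrite [qform X^T v]qformE bform_tr -qformE; lra.
Qed.

Lemma pos_def_qform_ge0 (R : realType) (m : nat) (X : 'M[R]_m) (v : 'cV[R]_m) :
  pos_def X -> 0 <= qform X v.
Proof.
move=> [_ Xpos]; have [->|/Xpos/ltW //] := eqVneq v 0.
by rewrite /qform mulmx0 mxE.
Qed.

Lemma pos_defZ (R : realType) (m : nat) (X : 'M[R]_m) a :
  0 < a -> pos_def X -> pos_def (a *: X).
Proof.
move=> a_gt0 [Xsym Xpos]; split; first by rewrite linearZ /= Xsym.
by move=> v /Xpos Xv; rewrite qformZ mulr_gt0.
Qed.

Definition energy_norm {R : realType} {m : nat} (X : 'M[R]_m) (v : 'cV[R]_m) :=
  Num.sqrt (qform X v).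

Lemma energy_norm_ge0 (R : realType) (m : nat) (X : 'M[R]_m) (v : 'cV[R]_m) :
  0 <= energy_norm X v.
Proof. exact: sqrtr_ge0. Qed.

Lemma sqr_energy_norm (R : realType) (m : nat) (X : 'M[R]_m) (v : 'cV[R]_m) :
  pos_def X -> energy_norm X v ^+ 2 = qform X v.
Proof. by move=> Xpd; rewrite sqr_sqrtr// pos_def_qform_ge0. Qed.

(** Cauchy-Schwarz inequality: the quadratic form at
    [qform X v *: w - bform X v w *: v] is [qform X v] times the defect
    [qform X v * qform X w - bform X v w ^+ 2]. *)
Lemma bform_le_energy_norm (R : realType) (m : nat) (X : 'M[R]_m)
    (v w : 'cV[R]_m) :
  pos_def X -> bform X v w <= energy_norm X v * energy_norm X w.
Proof.
move=> Xpd; have [Xsym Xpos] := Xpd.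
have [->|/Xpos qv_gt0] := eqVneq v 0.
  rewrite /bform trmx0 !mul0mx mxE.
  by apply: mulr_ge0; apply: energy_norm_ge0.
have defect : 0 <= qform X v * (qform X v * qform X w - bform X v w ^+ 2).
  have := pos_def_qform_ge0 _ _ _ (qform X v *: w - bform X v w *: v) Xpd.
  have wv : bform X w v = bform X v w by rewrite -{1}Xsym bform_tr.
  rewrite qformE -scaleNr !(bformDl, bformDr, bformZl, bformZr) wv -!qformE.
  by congr (0 <= _); ring.
move: defect; rewrite pmulr_rge0// subr_ge0 => b2_le.
rewrite -sqrtrM; last exact: ltW.
by rewrite (le_trans (ler_norm _))// -sqrtr_sqr ler_wsqrtr.
Qed.

(** The pairing of [w - v] with [w + v] is a difference of squares, and so
    contains the factor [|w| + |v|] that Cauchy-Schwarz produces on the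
    source side. *)
Lemma energy_norm_step (R : realType) (m : nat) (X A : 'M[R]_m) (tau : R)
    (v w f : 'cV[R]_m) :
  pos_def X -> (forall s, qform (X *m A) s <= 0) -> 0 < tau ->
  tau^-1 *: (w - v) = A *m (v + w) + f ->
  energy_norm X w <= energy_norm X v + tau * energy_norm X f.
Proof.
move=> Xpd XA_le0 tau_gt0 step; have [Xsym _] := Xpd.
have vw : bform X v w = bform X w v by rewrite -{1}Xsym bform_tr.
have balance : tau^-1 * (qform X w - qform X v)
    = qform (X *m A) (v + w) + bform X (v + w) f.
  transitivity (bform X (v + w) (tau^-1 *: (w - v))).
    by rewrite bformZr !(bformDl, bformDr, bformNr) vw !qformE; ring.
  by rewrite step bformDr /qform /bform !mulmxA.
have := XA_le0 (v + w).
have := bform_le_energy_norm _ _ _ v f Xpd.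
have := bform_le_energy_norm _ _ _ w f Xpd.
move: balance; rewrite bformDl -!(sqr_energy_norm _ _ X)//.
have := energy_norm_ge0 _ _ X v; have := energy_norm_ge0 _ _ X w.
have := energy_norm_ge0 _ _ X f.
move: (energy_norm X w) (energy_norm X v) (energy_norm X f) => a b c.
move=> c_ge0 a_ge0 b_ge0 balance wf vf XAs.
have factored : (a + b) * (a - b) <= (a + b) * (tau * c).
  have -> : (a + b) * (a - b) = tau * (tau^-1 * (a ^+ 2 - b ^+ 2)).
    by rewrite mulVKf ?gt_eqF//; ring.
  by rewrite [leRHS]mulrCA ler_pM2l// balance; lra.
have tc_ge0 : 0 <= tau * c by rewrite mulr_ge0// ltW.
(* If the common factor vanishes, so do both norms. *)
have [ab_le0|ab_gt0] := leP (a + b) 0; first by lra.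
by rewrite -lerBlDl -(ler_pM2l ab_gt0).
Qed.

Lemma energy_norm_growth (R : realType) (m : nat) (X A : 'M[R]_m) (tau F : R)
    (u f : nat -> 'cV[R]_m) (n : nat) :
  pos_def X -> (forall s, qform (X *m A) s <= 0) -> 0 < tau ->
  (forall k, (1 <= k <= n)%N ->
     tau^-1 *: (u k - u k.-1) = A *m (u k.-1 + u k) + f k) ->
  (forall k, (1 <= k <= n)%N -> energy_norm X (f k) <= F) ->
  energy_norm X (u n) <= energy_norm X (u 0) + n%:R * tau * F.
Proof.
move=> Xpd XA_le0 tau_gt0; elim: n => [|n IHn] step f_le.
  by rewrite !mul0r addr0.
have step_n := energy_norm_step _ _ _ _ _ _ _ _ Xpd XA_le0 tau_gt0
  (step n.+1 (leqnn _)).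
have IH : energy_norm X (u n) <= energy_norm X (u 0) + n%:R * tau * F.
  by apply: IHn => k /andP[k1 kn]; [apply: step | apply: f_le];
     rewrite k1 leqW.
have tf_le : tau * energy_norm X (f n.+1) <= tau * F.
  by rewrite ler_pM2l// f_le/=.
apply: le_trans step_n _; rewrite -natr1 /=; lra.
Qed.

(** After the cross term is split by [2 * a * F <= a ^+ 2 + F ^+ 2], both
    coefficients are controlled by [(1 + T) ^+ 2 <= expR T ^+ 2]. *)
Lemma sqrD_le_expR (R : realType) (T a F : R) : 0 <= T ->
  (a + T * F) ^+ 2 <= expR (2 * T) * a ^+ 2 + (expR (2 * T) - 1) * F ^+ 2.
Proof.
move=> T_ge0.
have expT : (1 + T) ^+ 2 <= expR (2 * T).
  rewrite expRM_natl ler_sqr ?nnegrE ?expR_ge0 ?addr_ge0//.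
  exact: expR_ge1Dx.
have coef_ge0 : 0 <= expR (2 * T) - (1 + T + T ^+ 2) by nra.
have a_ge0 := mulr_ge0 coef_ge0 (sqr_ge0 a).
have F_ge0 := mulr_ge0 coef_ge0 (sqr_ge0 F).
have Ta_ge0 : 0 <= T ^+ 2 * a ^+ 2 by rewrite mulr_ge0// sqr_ge0.
have aF_ge0 : 0 <= T * (a - F) ^+ 2 by rewrite mulr_ge0// sqr_ge0.
lra.
Qed.

Lemma le_max_upto (R : realType) (F : nat -> R) (n k : nat) :
  (1 <= k <= n)%N -> F k <= max_upto F n.
Proof.
by move=> kn; apply: le_bigmax_seq; rewrite ?mem_index_iota.
Qed.

Lemma mesh_gt0 (R : realType) (a b : R) (M : nat) : a < b -> 0 < mesh a b M.
Proof. by move=> ab; rewrite divr_gt0// subr_gt0. Qed.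

Theorem theorem3p1 (R : realType) (alpha beta xL xR yL yR T : R)
    (d e phi : R -> R -> R) (f : R -> R -> R -> R)
    (Q : forall M1 M2 N : nat, 'M[R]_(M2 * M1)) :
  1 < alpha < 2 -> 1 < beta < 2 ->
  xL < xR -> yL < yR -> 0 < T ->
  (forall x y : R, xL < x < xR -> yL < y < yR -> 0 <= d x y) ->
  (forall x y : R, xL < x < xR -> yL < y < yR -> 0 <= e x y) ->
  class_D (A_mx alpha beta xL xR yL yR d e) Q ->
  forall M1 M2 N : nat, (0 < M1)%N -> (0 < M2)%N -> (0 < N)%N ->
  forall u : nat -> 'cV[R]_(M2 * M1),
  scheme_solution alpha beta xL xR yL yR T d e phi f N u ->
  forall n : nat, (1 <= n <= N)%N ->
  let h := mesh xL xR M1 * mesh yL yR M2 in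
  sqnorm h (Q M1 M2 N) (u n) <=
    expR (2 * T) *
      sqnorm h (Q M1 M2 N) (grid_vec xL xR yL yR M1 M2 phi)
    + (expR (2 * T) - 1) *
      max_upto
        (fun k => sqnorm h (Q M1 M2 N) (f_mid xL xR yL yR T f M1 M2 N k)) n.
Proof.
move=> _ _ xLR yLR T_gt0 _ _ [c QD] M1 M2 N M1_gt0 M2_gt0 N_gt0 u [u0 step] n.
move=> /andP[n_gt0 nN]; cbv zeta; set h := mesh xL xR M1 * mesh yL yR M2.
have [Qpd [_ QA_ge0] _] := QD M1 M2 N M1_gt0 M2_gt0 N_gt0.
have h_gt0 : 0 < h by rewrite mulr_gt0 ?mesh_gt0.
(* The mesh weight goes into the matrix, so that [sqnorm h] is its quadratic
   form and the lemmas above apply verbatim. *)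
pose X := h *: Q M1 M2 N.
have sqnormE v : sqnorm h (Q M1 M2 N) v = qform X v by rewrite qformZ.
have Xpd : pos_def X by apply: pos_defZ.
have XA_le0 s : qform (X *m A_mx alpha beta xL xR yL yR d e M1 M2) s <= 0.
  rewrite -scalemxAl qformZ pmulr_rle0//.
  by have := QA_ge0 s; rewrite qform_sym_part oppr_ge0.
set mf := max_upto _ n.
have f_le k : (1 <= k <= n)%N ->
    qform X (f_mid xL xR yL yR T f M1 M2 N k) <= mf.
  by rewrite -sqnormE; apply: le_max_upto.
have mf_ge0 : 0 <= mf.
  by apply: le_trans (f_le 1%N _); rewrite ?pos_def_qform_ge0.
have NR_gt0 : 0 < N%:R :> R by rewrite ltr0n.
have := energy_norm_growth _ _ _ _ (T / N%:R) (Num.sqrt mf) u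
  (f_mid xL xR yL yR T f M1 M2 N) n Xpd XA_le0.
move=> /(_ (divr_gt0 T_gt0 NR_gt0)) growth.
have {}growth : energy_norm X (u n)
    <= energy_norm X (u 0%N) + T * Num.sqrt mf.
  apply: le_trans (growth _ _) _.
  - by move=> k /andP[k1 kn]; apply: step; rewrite k1 (leq_trans kn).
  - by move=> k kn; rewrite ler_wsqrtr// f_le.
  rewrite lerD2l ler_wpM2r ?sqrtr_ge0//.
  by rewrite mulrCA ger_pMr// ler_pdivrMr// mul1r ler_nat.
rewrite !sqnormE -u0 -!sqr_energy_norm// -[mf]sqr_sqrtr//.
apply: le_trans (sqrD_le_expR _ _ _ _ (ltW T_gt0)).
rewrite ler_sqr ?nnegrE ?energy_norm_ge0//.
by rewrite addr_ge0 ?energy_norm_ge0// mulr_ge0 ?sqrtr_ge0// ltW.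
Qed.
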